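(* Let $N\in\mathbb N$, and let $\mathsf a,\mathsf b\ge0$, $-1<\mathsf c,\mathsf d\le0$, $0\le q<1$ satisfy $\mathsf a\mathsf b<1$. Then the normalization constant $$Z_N^{(q,\mathsf a,\mathsf b,\mathsf c,\mathsf d)}=\sum_{\boldsymbol\lambda\in\mathcal{TL}_N}\mathrm{wt}_N^{(q,\mathsf a,\mathsf b,\mathsf c,\mathsf d)}(\boldsymbol\lambda)$$ is finite, hence the two-layer measure $\mathbb P_N^{(q,\mathsf a,\mathsf b,\mathsf c,\mathsf d)}(\boldsymbol\lambda)=\mathrm{wt}_N^{(q,\mathsf a,\mathsf b,\mathsf c,\mathsf d)}(\boldsymbol\lambda)/Z_N^{(q,\mathsf a,\mathsf b,\mathsf c,\mathsf d)}$ is a well-defined probability measure on $\mathcal{TL}_N$. Moreover, the marginal distribution of $\mathbb P_N^{(q,\mathsf a,\mathsf b,\mathsf c,\mathsf d)}$ on the first layer $\boldsymbol\lambda_1=(\lambda_1(0),\dots,\lambda_1(N))$ is the same as the law of the height function $(\tau_1+\dots+\tau_j)_{j\in\{0,\dots,N\}}$ where $(\tau_1,\dots,\tau_N)$ is distributed according to the stationary measure $\mu_N^{(q,\mathsf a,\mathsf b,\mathsf c,\mathsf d)}$ of the open ASEP.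
   Context: **Open ASEP.** Let $\alpha,\beta>0$, $\gamma,\delta\ge0$, $0\le q<1$. The open ASEP on $\{1,\dots,N\}$ is the irreducible continuous-time Markov process on $\{0,1\}^N$, with states $(\tau_1,\dots,\tau_N)$ ($\tau_i=1$ if site $i$ is occupied by a particle, $\tau_i=0$ if it is empty), in which: each particle in the bulk attempts to jump one site to the right at rate $1$ and one site to the left at rate $q$, the attempt succeeding only if the target site is empty; at site $1$ a particle enters at rate $\alpha$ if the site is empty, and a particle at site $1$ is removed at rate $\gamma$; at site $N$ a particle enters at rate $\delta$ if the site is empty, and a particle at site $N$ is removed at rate $\beta$. All clocks are independent. **Reparameterization.** For $x>0$, $y\ge0$ set $$\phi_\pm(x,y)=\frac1{2x}\Big(1-q-x+y\pm\sqrt{(1-q-x+y)^2+4xy}\Big),$$ and $\mathsf a=\phi_+(\alpha,\gamma)$, $\mathsf b=\phi_+(\beta,\delta)$, $\mathsf c=\phi_-(\alpha,\gamma)$, $\mathsf d=\phi_-(\beta,\delta)$. This is a bijection between parameters $(\alpha,\beta,\gamma,\delta,q)$ with $\alpha,\beta>0$, $\gamma,\delta\ge0$, $0\le q<1$ and parameters $(\mathsf a,\mathsf b,\mathsf c,\mathsf d,q)$ with $\mathsf a,\mathsf b\ge0$, $-1<\mathsf c,\mathsf d\le0$, $0\le q<1$. The unique stationary probability measure of the process on $\{0,1\}^N$ with the corresponding rates is denoted $\mu_N^{(q,\mathsf a,\mathsf b,\mathsf c,\mathsf d)}$. **Two-layer configurations.** $\mathcal{TL}_N$ is the set of $\boldsymbol\lambda=(\boldsymbol\lambda_1,\boldsymbol\lambda_2)\in\mathbb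 Z^{2N+2}$, $\boldsymbol\lambda_i=(\lambda_i(0),\dots,\lambda_i(N))$, such that $\lambda_1(0)=0$; $\lambda_1(j)\ge\lambda_2(j)$ for $0\le j\le N$; and $\lambda_i(j)-\lambda_i(j-1)\in\{0,1\}$ for $i\in\{1,2\}$, $1\le j\le N$. **Two-layer weight.** Let $(z;q)_n=\prod_{j=0}^{n-1}(1-zq^j)$. With the convention $0^0=1$, for $\boldsymbol\lambda\in\mathcal{TL}_N$, $$\mathrm{wt}_N^{(q,\mathsf a,\mathsf b,\mathsf c,\mathsf d)}(\boldsymbol\lambda)=\mathsf a^{\lambda_1(0)-\lambda_2(0)}\,\mathsf b^{\lambda_1(N)-\lambda_2(N)}\,\frac{(\mathsf c\mathsf d;q)_{\lambda_1(N)-\lambda_2(N)}}{(q;q)_{\lambda_1(N)-\lambda_2(N)}}\prod_{j=1}^N W^{(q,\mathsf c,\mathsf d)}\big(\lambda_1(j)-\lambda_2(j)\,\big|\,\lambda_1(j)-\lambda_1(j-1),\,\lambda_2(j)-\lambda_2(j-1)\big),$$ where for $x\in\mathbb Z_{\ge0}$: $W^{(q,\mathsf c,\mathsf d)}(x\mid1,0)=1-q^x$, $W^{(q,\mathsf c,\mathsf d)}(x\mid1,1)=1+\mathsf d q^x$, $W^{(q,\mathsf c,\mathsf d)}(x\mid0,0)=1+\mathsf c q^x$, $W^{(q,\mathsf c,\mathsf d)}(x\mid0,1)=1-\mathsf c\mathsf d q^x$. *)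

(* Defs.v *)
From HB Require Import structures.
From mathcomp Require Import all_boot all_order all_algebra.
From mathcomp Require Import all_classical all_reals all_analysis.

Set Implicit Arguments.
Unset Strict Implicit.
Unset Printing Implicit Defensive.

Import Order.TTheory GRing.Theory Num.Theory.

Local Open Scope classical_set_scope.
Local Open Scope ring_scope.

(* Sites are numbered from 0: [i : 'I_N] stands for site i + 1. *)
Definition config (N : nat) := {ffun 'I_N -> bool}.

HB.instance Definition _ N := Finite.on (config N).
HB.instance Definition _ N := isPointed.Build (config N) [ffun=> false].
HB.instance Definition _ N := @isMeasurable.Build default_measure_display
  (config N) discrete_measurable
  discrete_measurable0 discrete_measurableC discrete_measurableU.

Definition lattice_path (N : nat) := {ffun 'I_N.+1 -> int}.

HB.instance Definition _ N := Choice.on (lattice_path N).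
HB.instance Definition _ N := isPointed.Build (lattice_path N) [ffun=> 0].
HB.instance Definition _ N := @isMeasurable.Build default_measure_display
  (lattice_path N) discrete_measurable
  discrete_measurable0 discrete_measurableC discrete_measurableU.

(* [path_step p i] is p(i + 1) - p(i). *)
Definition path_step N (p : lattice_path N) (i : 'I_N) : int :=
  p (lift ord0 i) - p (widen_ord (leqnSn N) i).

Definition is_two_layer N (l : lattice_path N * lattice_path N) : bool :=
  [&& l.1 ord0 == 0,
      [forall j, l.2 j <= l.1 j],
      [forall i, path_step l.1 i \in [:: 0; 1]] &
      [forall i, path_step l.2 i \in [:: 0; 1]]].

Record two_layer (N : nat) := TwoLayer {
  two_layer_val :> lattice_path N * lattice_path N;
  two_layerP : is_two_layer two_layer_val }.

HB.instance Definition _ N := [isSub for @two_layer_val N].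
HB.instance Definition _ N := [Choice of two_layer N by <:].

Lemma is_two_layer0 N :
  is_two_layer ([ffun=> 0] : lattice_path N, [ffun=> 0] : lattice_path N).
Proof.
rewrite /is_two_layer /= ffunE eqxx /=.
by apply/and3P; split; apply/forallP => i; rewrite ?/path_step !ffunE.
Qed.

HB.instance Definition _ N := isPointed.Build (two_layer N)
  (TwoLayer (is_two_layer0 N)).
HB.instance Definition _ N := @isMeasurable.Build default_measure_display
  (two_layer N) discrete_measurable
  discrete_measurable0 discrete_measurableC discrete_measurableU.

Definition layer1 N (l : two_layer N) : lattice_path N := (two_layer_val l).1.
Definition layer2 N (l : two_layer N) : lattice_path N := (two_layer_val l).2.

(* The difference is nonnegative on [two_layer N], so [absz] loses nothing. *)
Definition gap N (l : two_layer N) (j : 'I_N.+1) : nat :=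
  absz (layer1 l j - layer2 l j).

Section Weight.
Variables (R : realType) (N : nat) (q a b c d : R).

Definition qpochhammer (z : R) (n : nat) : R := \prod_(j < n) (1 - z * q ^+ j).

(* A step is encoded by [true] for +1 and [false] for 0. *)
Definition local_weight (x : nat) (s1 s2 : bool) : R :=
  match s1, s2 with
  | true, false => 1 - q ^+ x
  | true, true => 1 + d * q ^+ x
  | false, false => 1 + c * q ^+ x
  | false, true => 1 - c * d * q ^+ x
  end.

Definition two_layer_wt (l : two_layer N) : R :=
  a ^+ gap l ord0 * b ^+ gap l ord_max *
  (qpochhammer (c * d) (gap l ord_max) / qpochhammer q (gap l ord_max)) *
  \prod_(i < N) local_weight (gap l (lift ord0 i))
                  (path_step (layer1 l) i == 1) (path_step (layer2 l) i == 1).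

Definition two_layer_Z : \bar R :=
  \esum_(l in [set: two_layer N]) (two_layer_wt l)%:E.

Definition two_layer_prob (l : two_layer N) : R :=
  two_layer_wt l / fine two_layer_Z.

End Weight.

Section OpenASEP.
Variables (R : realType) (N : nat).

Definition exchange (i j : 'I_N) (s : config N) : config N :=
  [ffun k => if k == i then s j else if k == j then s i else s k].

Definition flip (i : 'I_N) (s : config N) : config N :=
  [ffun k => if k == i then ~~ s i else s k].

(* Total rate of the jumps from [s] to [t]. When N = 1 both reservoirs act on
   the same site and their rates add up. *)
Definition asep_rate (alpha beta gamma delta q : R) (s t : config N) : R :=
    \sum_(i < N) \sum_(j < N | (j == i.+1 :> nat) && (t == exchange i j s))
      (if s i && ~~ s j then 1 else if ~~ s i && s j then q else 0)
  + \sum_(i < N | (i == 0 :> nat) && (t == flip i s))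
      (if s i then gamma else alpha)
  + \sum_(i < N | (i.+1 == N) && (t == flip i s))
      (if s i then beta else delta).

Definition asep_generator (alpha beta gamma delta q : R) (s t : config N) : R :=
  if s == t then - \sum_(u | u != s) asep_rate alpha beta gamma delta q s u
  else asep_rate alpha beta gamma delta q s t.

(* A law [mu] is stationary for a finite-state continuous-time chain with
   Q-matrix Q when mu Q = 0. *)
Definition asep_stationary (alpha beta gamma delta q : R)
    (mu : probability (config N) R) : Prop :=
  forall t, \sum_(s : config N)
    fine (mu [set s]) * asep_generator alpha beta gamma delta q s t = 0.

Definition phi_plus (q x y : R) : R :=
  (2 * x)^-1 *
  (1 - q - x + y + Num.sqrt ((1 - q - x + y) ^+ 2 + 4 * x * y)).

Definition phi_minus (q x y : R) : R :=
  (2 * x)^-1 *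
  (1 - q - x + y - Num.sqrt ((1 - q - x + y) ^+ 2 + 4 * x * y)).

Definition asep_parameters (q a b c d alpha beta gamma delta : R) : Prop :=
  [/\ [/\ 0 < alpha, 0 < beta, 0 <= gamma & 0 <= delta],
      a = phi_plus q alpha gamma, b = phi_plus q beta delta,
      c = phi_minus q alpha gamma & d = phi_minus q beta delta].

Definition asep_stationary_measure (q a b c d : R)
    (mu : probability (config N) R) : Prop :=
  exists alpha beta gamma delta : R,
    asep_parameters q a b c d alpha beta gamma delta /\
    asep_stationary alpha beta gamma delta q mu.

Definition height (s : config N) : lattice_path N :=
  [ffun j : 'I_N.+1 => (\sum_(i < N | (i < j)%N) s i)%:Z].

End OpenASEP.

(* Main.v *)
Require Import Defs.
From HB Require Import structures.
From mathcomp Require Import all_boot all_order all_algebra.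
From mathcomp Require Import all_classical all_reals all_analysis.
From mathcomp Require Import ring lra zify.

(** The stationary law of the open ASEP is given by a matrix product, and the
two-layer weight is this matrix product with every matrix entry written out.

Fix the first layer, that is a word [w] in occupied and empty sites.  The
gap between the two layers is then a walk on the nonnegative integers: an
occupied site makes it stay or go up, an empty site makes it stay or go down,
according to the step of the second layer.  Let D and E be the two infinite
bidiagonal matrices whose entries are the local weights of these transitions
([transfer true] and [transfer false], acting on functions of the gap).
Summing the two-layer weight over the second layer gives the number
F(w) = W X_1 ... X_N V, where X_i is D or E according to the i-th letter, W is
the row vector with entries a^k, and V the column vector with entries
b^k (cd; q)_k / (q; q)_k.  This is [two_layer_esum]; it rests on the bijection
[encode_bij] between two-layer configurations and triples made of a particle
configuration, an initial gap and a second word.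

The vector V grows at most like t^k for a fixed t > b with a t < 1, which
exists because a b < 1; D and E preserve this growth, so all the series
converge and the partition function is finite.

Stationarity of F follows from three identities checked entry by entry:
D E - q E D = (1 - q) (D + E) ([transfer_bulk]),
W (E + ac D) = (1 + a)(1 + c) W ([word_weight_left]) and
(D + bd E) V = (1 + b)(1 + d) V ([transfer_right]).
By the first one, the net probability flow through the bond (i, i + 1) is a
difference of a site quantity at i and at i + 1, so the flows through all bonds
telescope; the other two identities say that the remaining boundary terms are
cancelled by the reservoirs ([channels_balance]).  Here the rates are recovered
from the parameters through
(1 + a)(1 + c) alpha = 1 - q and gamma = - ac alpha, and similarly for beta and
delta, since a and c are the two roots of a quadratic polynomial
([phi_relations], [phi_inverse]).

Finally F is positive, so one can form the ratio of any stationary law to F.  By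
the maximum principle, its maximum and its minimum propagate along the jumps of
the process, read backwards, down to the empty configuration
([balanced_unique], [asep_reach_empty]), so the stationary law is unique. *)

Set Implicit Arguments.
Unset Strict Implicit.
Unset Printing Implicit Defensive.

Import Order.TTheory GRing.Theory Num.Theory.
Import numFieldNormedType.Exports.

Local Open Scope classical_set_scope.
Local Open Scope ring_scope.

(** * Transfer matrices and their quadratic algebra *)

Section TransferAlgebra.
Variables (R : realType) (q a b c d : R).

(** The matrix D (for [true]) or E (for [false]) applied to a column vector; the
row index [k] is the gap before the step, whereas [local_weight] takes the gap
after it. *)
Definition transfer (s : bool) (u : nat -> R) (k : nat) : R :=
  if s then local_weight q c d k true true * u k +
            local_weight q c d k.+1 true false * u k.+1
  else local_weight q c d k false false * u k +
       (if k is j.+1 then local_weight q c d j false true * u j else 0).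

(** The column vector V. *)
Definition right_vector (k : nat) : R :=
  b ^+ k * (qpochhammer q (c * d) k / qpochhammer q q k).

(** The relation D E - q E D = (1 - q) (D + E): the diagonal and the two
off-diagonals agree separately.  Row 0 needs no correction: a
detour through gap -1 would return to gap 0 with weight 1 - q^0 = 0. *)
Lemma transfer_bulk u k :
  transfer true (transfer false u) k - q * transfer false (transfer true u) k =
  (1 - q) * (transfer true u k + transfer false u k).
Proof. by case: k => [|k]; rewrite /transfer /local_weight !exprS ?expr0; ring. Qed.

Lemma qpochhammerS z k : qpochhammer q z k.+1 = qpochhammer q z k * (1 - z * q ^+ k).
Proof. by rewrite /qpochhammer big_ord_recr. Qed.

Lemma qpochhammer0 z : qpochhammer q z 0 = 1.
Proof. by rewrite /qpochhammer big_ord0. Qed.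

Hypothesis hq : 0 <= q < 1.

Lemma one_sub_exprS_gt0 k : 0 < 1 - q ^+ k.+1.
Proof. by rewrite subr_gt0 exprn_ilt1//; case/andP: hq. Qed.

Lemma expq_itv k : 0 <= q ^+ k <= 1.
Proof. by move: hq => /andP[q0 q1]; rewrite exprn_ge0//= exprn_ile1// ltW. Qed.

Lemma qpochhammer_gt0 k : 0 < qpochhammer q q k.
Proof. by apply: prodr_gt0 => i _; rewrite -exprS one_sub_exprS_gt0. Qed.

(** The ratio of consecutive entries is kept free of division by multiplying with
1 - q^(k+1), which is exactly the weight of an upward step to gap k + 1. *)
Lemma right_vectorS k :
  (1 - q ^+ k.+1) * right_vector k.+1 = b * (1 - c * d * q ^+ k) * right_vector k.
Proof.
rewrite /right_vector !qpochhammerS -exprS (exprS b).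
have := lt0r_neq0 (qpochhammer_gt0 k); have := lt0r_neq0 (one_sub_exprS_gt0 k).
set x := qpochhammer _ _ _; set y := qpochhammer _ _ _; set z := 1 - q ^+ _.
by move=> z0 y0; field; rewrite y0.
Qed.

(** In E V the entry b V_(k-1), times the weight of the downward step, equals
(1 - q^k) V_k by [right_vectorS], which makes the identity polynomial in q^k. *)
Lemma transfer_right k :
  transfer true right_vector k + b * d * transfer false right_vector k =
  (1 + b) * (1 + d) * right_vector k.
Proof.
rewrite /transfer /local_weight right_vectorS; case: k => [|k].
  by rewrite expr0; ring.
have /esym := right_vectorS k; set v := right_vector _; set w := right_vector _ => E.
have -> : b * d * ((1 + c * q ^+ k.+1) * w + (1 - c * d * q ^+ k) * v) =
  b * d * (1 + c * q ^+ k.+1) * w + d * (b * (1 - c * d * q ^+ k) * v) by ring.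
by rewrite E; ring.
Qed.

(** The identity W (E + ac D) = (1 + a)(1 + c) W tested on a vector: the terms that
involve the neighbours of [k] telescope over a finite range, and leave only a
boundary term at [n]. *)
Lemma transfer_left_partial u n :
  \sum_(0 <= k < n) a ^+ k * transfer false u k +
  a * c * \sum_(0 <= k < n) a ^+ k * transfer true u k =
  (1 + a) * (1 + c) * \sum_(0 <= k < n) a ^+ k * u k +
  (c * a ^+ n * (1 - q ^+ n) * u n -
   if n is j.+1 then a ^+ j.+1 * (1 - c * d * q ^+ j) * u j else 0).
Proof.
elim: n => [|n IH]; first by rewrite !big_geq// expr0; ring.
rewrite !big_nat_recr//= !mulrDr.
set A := \sum_(_ <= _ < _) _ in IH *; set B := \sum_(_ <= _ < _) _ in IH *.
set S := \sum_(_ <= _ < _) _ in IH *.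
clearbody A B S.
have {IH} -> : A = (1 + a) * (1 + c) * S + (c * a ^+ n * (1 - q ^+ n) * u n -
   match n with 0 => 0 | j.+1 => a ^+ j.+1 * (1 - c * d * q ^+ j) * u j end) - a * c * B.
  by rewrite -IH; ring.
by rewrite /transfer /local_weight; case: n => [|n]; rewrite !exprS ?expr0; ring.
Qed.

End TransferAlgebra.

(** * Geometrically bounded functions and their pairing with a geometric row *)

Section Pairing.
Variables (R : realType) (a t : R).
Hypotheses (a_ge0 : 0 <= a) (t_gt0 : 0 < t) (at_lt1 : a * t < 1).

Definition geo_bounded (u : nat -> R) := exists C, forall k, `|u k| <= C * t ^+ k.

Definition pairing (u : nat -> R) : R := limn (series (fun k => a ^+ k * u k)).

Lemma geo_boundedD u v : geo_bounded u -> geo_bounded v ->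
  geo_bounded (fun k => u k + v k).
Proof.
move=> [C hC] [D hD]; exists (C + D) => k.
by rewrite mulrDl (le_trans (ler_normD _ _))// lerD.
Qed.

Lemma geo_boundedM (f u : nat -> R) M : (forall k, `|f k| <= M) -> geo_bounded u ->
  geo_bounded (fun k => f k * u k).
Proof.
move=> hf [C hC]; exists (M * C) => k.
by rewrite normrM -mulrA ler_pM.
Qed.

Lemma geo_bounded_succ u : geo_bounded u -> geo_bounded (fun k => u k.+1).
Proof.
by move=> [C hC]; exists (C * t) => k; rewrite -mulrA -exprS hC.
Qed.

Lemma geo_bounded_pred u : geo_bounded u ->
  geo_bounded (fun k => if k is j.+1 then u j else 0).
Proof.
move=> [C hC]; have C0 : 0 <= C by have := hC 0; rewrite expr0 mulr1; apply: le_trans.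
exists (C / t) => -[|k]; first by rewrite normr0 mulr_ge0 ?exprn_ge0 ?divr_ge0// ltW.
by rewrite exprS mulrA divfK ?gt_eqF.
Qed.

(** The part of the sequence before the index [M], where the ratio is not yet
controlled, is absorbed in the constant by summing its normalized values. *)
Lemma geo_bounded_ratio u M : (forall k, 0 <= u k) ->
  (forall k, (M <= k)%N -> u k.+1 <= t * u k) -> geo_bounded u.
Proof.
move=> u0 hM; pose C := \sum_(i < M.+1) u i / t ^+ i.
have terms_ge0 i : 0 <= u i / t ^+ i by rewrite divr_ge0 ?exprn_ge0// ltW.
exists C => k; rewrite ger0_norm//.
have small i : (i <= M)%N -> u i <= C * t ^+ i.
  move=> iM; rewrite -ler_pdivrMr ?exprn_gt0// /C.
  have iM' : (i < M.+1)%N by [].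
  by rewrite (bigD1 (Ordinal iM'))//= lerDl sumr_ge0.
elim: k => [|k IH]; first exact: small.
have [kM|Mk] := leqP k.+1 M; first exact: small.
rewrite (le_trans (hM k _))//; rewrite exprS mulrCA ler_pM2l//.
Qed.

Lemma pairing_summable u : geo_bounded u ->
  cvgn (series (fun k => `|a ^+ k * u k|)).
Proof.
move=> [C hC].
apply: (@series_le_cvg _ _ (fun k => C * (a * t) ^+ k)) => [k|k|k|].
- by [].
- by apply: mulr_ge0; [have := hC 0; rewrite expr0 mulr1; apply: le_trans|
    rewrite exprn_ge0// mulr_ge0// ltW].
- rewrite normrM ger0_norm ?exprn_ge0// exprMn mulrCA.
  by rewrite ler_wpM2l ?exprn_ge0.
- by apply: is_cvg_geometric_series; rewrite ger0_norm// mulr_ge0// ltW.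
Qed.

Lemma pairing_cvg u : geo_bounded u -> cvgn (series (fun k => a ^+ k * u k)).
Proof. by move=> /pairing_summable; apply: normed_cvg. Qed.

Lemma pairing_cvg_to u : geo_bounded u ->
  series (fun k => a ^+ k * u k) @ \oo --> pairing u.
Proof. exact: pairing_cvg. Qed.

Lemma pairing_term_cvg0 u : geo_bounded u -> (fun k => a ^+ k * u k) @ \oo --> (0 : R).
Proof. by move=> /pairing_cvg; apply: cvg_series_cvg_0. Qed.

Lemma pairing_lin u v x y : geo_bounded u -> geo_bounded v ->
  pairing (fun k => x * u k + y * v k) = x * pairing u + y * pairing v.
Proof.
move=> gu gv; apply: cvg_lim => //.
rewrite (_ : series _ = x \*: series (fun k => a ^+ k * u k) +
                        y \*: series (fun k => a ^+ k * v k)); last first.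
  apply/funext => n; rewrite /series/= !fctE /= !scaler_sumr -big_split/=.
  by apply: eq_bigr => i _; rewrite /GRing.scale/=; ring.
by apply: cvgD; apply: cvgZl_tmp; apply: pairing_cvg_to.
Qed.

Lemma pairing_ge_head u : geo_bounded u -> (forall k, 0 <= u k) -> u 0 <= pairing u.
Proof.
move=> gu u0; apply: (limr_ge (pairing_cvg gu)); near=> n.
have n0 : (0 < n)%N by near: n; exact: nbhs_infty_gt.
rewrite /series/= big_ltn//= expr0 mul1r lerDl; apply: sumr_ge0 => i _.
by rewrite mulr_ge0 ?exprn_ge0.
Unshelve. all: by end_near. Qed.

Lemma pairing_esum u : geo_bounded u -> (forall k, 0 <= u k) ->
  \esum_(k in [set: nat]) (a ^+ k * u k)%:E = (pairing u)%:E.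
Proof.
move=> gu u0.
rewrite -nneseries_esumT; last by move=> k; rewrite lee_fin mulr_ge0 ?exprn_ge0.
rewrite -EFin_lim; last exact: pairing_cvg.
by congr (limn _); apply/funext => n; rewrite /= /series/= -sumEFin.
Qed.

End Pairing.

(** * Matrix product weight of a word *)

Section WordWeight.
Variables (R : realType) (q a b c d : R).
Hypotheses (hq : 0 <= q < 1) (ha : 0 <= a) (hb : 0 <= b).
Hypotheses (hc : -1 < c <= 0) (hd : -1 < d <= 0) (hab : a * b < 1).

Local Notation transfer := (transfer q c d).
Local Notation right_vector := (right_vector q b c d).

(** Any t with b < t and a t < 1 serves; this choice satisfies
1 - a t = (1 - a b) / (1 + a), which also covers a = 0. *)
Definition growth_rate : R := b + (1 - a * b) / (1 + a).
Local Notation t := growth_rate.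

Lemma growth_rate_gt : b < t.
Proof. by rewrite ltrDl divr_gt0 ?subr_gt0// ltr_wpDr. Qed.

Lemma growth_rate_gt0 : 0 < t.
Proof. exact: le_lt_trans hb growth_rate_gt. Qed.

Lemma a_growth_rate_lt1 : a * t < 1.
Proof.
have a1 : 0 < 1 + a by rewrite ltr_wpDr.
suff -> : a * t = 1 - (1 - a * b) / (1 + a).
  by rewrite gtrBl divr_gt0 ?subr_gt0.
by rewrite /growth_rate; field; rewrite gt_eqF.
Qed.

(** All local weights are in the unit interval, as - 1 < c, d <= 0 gives
0 <= c d <= 1. *)
Lemma local_weight_itv k s1 s2 : 0 <= local_weight q c d k s1 s2 <= 1.
Proof.
move: hc hd (expq_itv hq k) => /andP[c1 c0] /andP[d1 d0] /andP[x0 x1].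
have cd : 0 <= c * d <= 1 by apply/andP; split; nra.
by case: s1 s2 => [] [] /=; apply/andP; split; nra.
Qed.

Lemma local_weight_ge0 k s1 s2 : 0 <= local_weight q c d k s1 s2.
Proof. by case/andP: (local_weight_itv k s1 s2). Qed.

Lemma local_weight_gt0 k s : 0 < local_weight q c d k s s.
Proof.
move: hc hd (expq_itv hq k) => /andP[c1 c0] /andP[d1 d0] /andP[x0 x1].
by case: s => /=; nra.
Qed.

Lemma local_weight_bound k s1 s2 : `|local_weight q c d k s1 s2| <= 1.
Proof. by rewrite ger0_norm; case/andP: (local_weight_itv k s1 s2). Qed.

Lemma transfer_ge0 s u : (forall k, 0 <= u k) -> forall k, 0 <= transfer s u k.
Proof.
move=> u0 k; rewrite /transfer.
by case: s; case: k => [|k]; rewrite ?addr_ge0// mulr_ge0// local_weight_ge0.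
Qed.

(** Only the entry at gap 0 is followed: for b = 0 all other entries of V vanish.
The diagonal entries of D and E are positive. *)
Lemma transfer_head_gt0 s u : (forall k, 0 <= u k) -> 0 < u 0 -> 0 < transfer s u 0.
Proof.
move=> u0 h; rewrite /transfer; case: s; rewrite ltr_pwDl//.
- by rewrite mulr_gt0// local_weight_gt0.
- by rewrite mulr_ge0// local_weight_ge0.
- by rewrite mulr_gt0// local_weight_gt0.
Qed.

Lemma transfer_geo_bounded s u : geo_bounded t u -> geo_bounded t (transfer s u).
Proof.
move=> gu; have t0 := growth_rate_gt0.
case: s; apply: geo_boundedD.
- by apply: geo_boundedM gu => k; exact: local_weight_bound.
- apply: (@geo_boundedM _ t (fun k => local_weight q c d k.+1 true false) (fun k => u k.+1)).
    by move=> k; exact: local_weight_bound.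
  exact: geo_bounded_succ.
- by apply: geo_boundedM gu => k; exact: local_weight_bound.
- apply: (geo_bounded_pred t0 (u := fun k => local_weight q c d k false true * u k)).
  by apply: geo_boundedM gu => k; exact: local_weight_bound.
Qed.

Lemma transfer_lin s u v x y :
  transfer s (fun k => x * u k + y * v k) =
  (fun k => x * transfer s u k + y * transfer s v k).
Proof. by apply/funext => -[|k]; case: s; rewrite /transfer; ring. Qed.

Lemma right_vector_ge0 k : 0 <= right_vector k.
Proof.
rewrite mulr_ge0 ?exprn_ge0// divr_ge0// ?(ltW (qpochhammer_gt0 hq k))//.
by apply: prodr_ge0 => i _; exact: (local_weight_ge0 i false true).
Qed.

Lemma right_vector_head : right_vector 0 = 1.
Proof. by rewrite /right_vector !qpochhammer0 expr0 invr1 !mulr1. Qed.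

(** The ratio of consecutive entries tends to b, which is smaller than the growth
rate. *)
Lemma right_vector_geo_bounded : geo_bounded t right_vector.
Proof.
have [M hM] : exists M, forall k, (M <= k)%N -> b <= t * (1 - q ^+ k.+1).
  have /cvgrPdist_lt/(_ (1 - b / t)) : (fun k => q ^+ k) @ \oo --> (0 : R).
    by apply: cvg_expr; rewrite ger0_norm; case/andP: hq.
  rewrite subr_gt0 ltr_pdivrMr ?growth_rate_gt0// mul1r growth_rate_gt => /(_ isT)[M _ hM].
  exists M => k Mk; have := hM k.+1 (leqW Mk).
  have [q0 _] := andP (expq_itv hq k.+1).
  rewrite /= sub0r normrN ger0_norm// => h.
  by rewrite mulrC -ler_pdivrMr ?growth_rate_gt0//; lra.
apply: (@geo_bounded_ratio _ _ growth_rate_gt0 _ M right_vector_ge0) => k /hM bt.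
have q1 := one_sub_exprS_gt0 hq k.
rewrite -(ler_pM2l q1) right_vectorS// [leRHS]mulrA [X in _ <= X * _]mulrC.
apply: ler_wpM2r; first exact: right_vector_ge0.
apply: le_trans bt; rewrite ler_piMr//.
by case/andP: (local_weight_itv k false true).
Qed.

Definition word_vector (w : seq bool) : nat -> R := foldr transfer right_vector w.

Definition word_weight (w : seq bool) : R := pairing a (word_vector w).

Lemma word_vector_ge0 w k : 0 <= word_vector w k.
Proof.
elim: w k => [|s w IH] k /=; first exact: right_vector_ge0.
exact: transfer_ge0.
Qed.

Lemma word_vector_head_gt0 w : 0 < word_vector w 0.
Proof.
elim: w => [|s w IH] /=; first by rewrite right_vector_head.
by apply: transfer_head_gt0 => // k; exact: word_vector_ge0.
Qed.

Lemma foldr_transfer_geo_bounded w u :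
  geo_bounded t u -> geo_bounded t (foldr transfer u w).
Proof. by move=> gu; elim: w => //= s w; exact: transfer_geo_bounded. Qed.

Lemma word_vector_geo_bounded w : geo_bounded t (word_vector w).
Proof. exact: foldr_transfer_geo_bounded right_vector_geo_bounded. Qed.

Lemma foldr_transfer_lin w u v x y :
  foldr transfer (fun k => x * u k + y * v k) w =
  (fun k => x * foldr transfer u w k + y * foldr transfer v w k).
Proof. by elim: w => //= s w ->; exact: transfer_lin. Qed.

Lemma pairing_foldr_lin w u v x y : geo_bounded t u -> geo_bounded t v ->
  pairing a (foldr transfer (fun k => x * u k + y * v k) w) =
  x * pairing a (foldr transfer u w) + y * pairing a (foldr transfer v w).
Proof.
move=> gu gv; rewrite foldr_transfer_lin.
by apply: (pairing_lin ha growth_rate_gt0 a_growth_rate_lt1);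
  exact: foldr_transfer_geo_bounded.
Qed.

Lemma word_weight_gt0 w : 0 < word_weight w.
Proof.
apply: lt_le_trans (word_vector_head_gt0 w) _.
apply: (pairing_ge_head ha growth_rate_gt0 a_growth_rate_lt1).
  exact: word_vector_geo_bounded.
exact: word_vector_ge0.
Qed.

(** The bulk relation in the middle of a word, by linearity of the letters before it. *)
Lemma word_weight_bulk w1 w2 :
  word_weight (w1 ++ [:: true, false & w2]) - q * word_weight (w1 ++ [:: false, true & w2]) =
  (1 - q) * (word_weight (w1 ++ true :: w2) + word_weight (w1 ++ false :: w2)).
Proof.
rewrite /word_weight /word_vector !foldr_cat /= -/(word_vector w2).
set u := word_vector w2.
have gu s : geo_bounded t (transfer s u).
  exact: transfer_geo_bounded (word_vector_geo_bounded _).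
have g2 s s' : geo_bounded t (transfer s (transfer s' u)) by exact: transfer_geo_bounded.
have := pairing_foldr_lin w1 1 (- q) (g2 true false) (g2 false true).
have := pairing_foldr_lin w1 (1 - q) (1 - q) (gu true) (gu false).
rewrite mul1r -mulrDr mulNr => <- <-; congr (pairing a (foldr _ _ w1)).
by apply/funext => k; rewrite mul1r mulNr transfer_bulk mulrDr.
Qed.

Lemma word_weight_right w :
  word_weight (rcons w true) + b * d * word_weight (rcons w false) =
  (1 + b) * (1 + d) * word_weight w.
Proof.
rewrite /word_weight /word_vector !foldr_rcons.
have gv := right_vector_geo_bounded.
have gs s : geo_bounded t (transfer s right_vector) by exact: transfer_geo_bounded.
have := pairing_foldr_lin w 1 (b * d) (gs true) (gs false).
have := pairing_foldr_lin w ((1 + b) * (1 + d)) 0 gv gv.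
rewrite mul1r mul0r addr0 => <- <-; congr (pairing a (foldr _ _ w)).
by apply/funext => k; rewrite mul1r mul0r addr0 transfer_right.
Qed.

(** Limit of [transfer_left_partial]: the boundary term is a difference of two
summands of convergent series. *)
Lemma word_weight_left w :
  word_weight (false :: w) + a * c * word_weight (true :: w) =
  (1 + a) * (1 + c) * word_weight w.
Proof.
have t0 := growth_rate_gt0; have at1 := a_growth_rate_lt1.
rewrite /word_weight /= -/(word_vector w); set u := word_vector w.
have gu : geo_bounded t u by exact: word_vector_geo_bounded.
have gs s : geo_bounded t (transfer s u) by exact: transfer_geo_bounded.
have cvgL := pairing_cvg_to ha t0 at1 (gs false).
have cvgLt := pairing_cvg_to ha t0 at1 (gs true).
have cvgu := pairing_cvg_to ha t0 at1 gu.
have lhs := cvgD cvgL (cvgMl_tmp (a := a * c) cvgLt).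
pose e n := c * a ^+ n * (1 - q ^+ n) * u n -
   if n is j.+1 then a ^+ j.+1 * (1 - c * d * q ^+ j) * u j else 0.
have e0 : e @ \oo --> (0 : R).
  rewrite -[0](subr0 0) -[X in X - 0](mulr0 c).
  have gP : geo_bounded t
      (fun n => if n is j.+1 then local_weight q c d j false true * u j else 0).
    apply: (geo_bounded_pred t0 (u := fun k => local_weight q c d k false true * u k)).
    by apply: geo_boundedM gu => k; exact: local_weight_bound.
  have gQ : geo_bounded t (fun n => local_weight q c d n true false * u n).
    by apply: geo_boundedM gu => k; exact: local_weight_bound.
  pose f n := if n is j.+1 then local_weight q c d j false true * u j else 0.
  rewrite (_ : e = (fun n => c * (a ^+ n * (local_weight q c d n true false * u n))) -
                   (fun n => a ^+ n * f n)); last first.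
    by apply/funext => -[|n]; rewrite /e /f /= !fctE /=; ring.
  exact: cvgB (cvgMl_tmp (a := c) (pairing_term_cvg0 ha t0 at1 gQ))
              (pairing_term_cvg0 ha t0 at1 gP).
have rhs := cvgD (cvgMl_tmp (a := (1 + a) * (1 + c)) cvgu) e0.
rewrite addr0 in rhs; rewrite -[LHS](cvg_lim _ (lhs _ _))// -[RHS](cvg_lim _ (rhs _ _))//.
congr (limn _); apply/funext => n.
exact: transfer_left_partial.
Qed.

End WordWeight.

(** * Stationarity of a matrix product *)

(** A configuration as a word, so that matrix products can be cut at any site. *)
Definition word N (s : config N) : N.-tuple bool := [tuple s i | i < N].
Arguments word : simpl never.

Lemma nth_word N (s : config N) (i : 'I_N) : nth false (word s) i = s i.
Proof. exact: nth_mktuple. Qed.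

Lemma exchangeK N (i j : 'I_N) : involutive (exchange i j).
Proof.
move=> s; apply/ffunP => k; rewrite !ffunE eqxx.
have [->|ki] := eqVneq k i; first by have [->|ji] := eqVneq j i; rewrite ?eqxx.
by have [->|kj] := eqVneq k j; rewrite ?eqxx.
Qed.

Lemma flipK N (i : 'I_N) : involutive (flip i).
Proof.
by move=> s; apply/ffunP => k; rewrite !ffunE; case: eqVneq => // ->; rewrite eqxx negbK.
Qed.

Lemma word_split N (s : config N) (i : 'I_N) :
  word s = take i (word s) ++ s i :: drop i.+1 (word s) :> seq bool.
Proof. by rewrite -nth_word -drop_nth ?size_tuple// cat_take_drop. Qed.

Lemma word_flip N (s : config N) (i : 'I_N) :
  word (flip i s) = take i (word s) ++ ~~ s i :: drop i.+1 (word s) :> seq bool.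
Proof.
have -> : ~~ s i = flip i s i by rewrite ffunE eqxx.
rewrite {1}(word_split (flip i s) i); congr (_ ++ _ :: _).
  apply: (@eq_from_nth _ false); rewrite !size_take !size_tuple// ltn_ord => k ki.
  rewrite !nth_take//; have kN := ltn_trans ki (ltn_ord i).
  rewrite !(nth_word _ (Ordinal kN)) ffunE -val_eqE /=; case: eqP => //; lia.
apply: (@eq_from_nth _ false); rewrite !size_drop !size_tuple// => k ki.
rewrite !nth_drop; have kN : (i.+1 + k < N)%N by lia.
by rewrite !(nth_word _ (Ordinal kN)) ffunE -val_eqE /=; case: eqP => //; lia.
Qed.

Lemma word_split2 N (s : config N) (i j : 'I_N) : j = i.+1 :> nat ->
  word s = take i (word s) ++ [:: s i, s j & drop i.+2 (word s)] :> seq bool.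
Proof.
by move=> ji; rewrite {1}(word_split s i) -ji (drop_nth false) ?size_tuple// nth_word ji.
Qed.

Lemma word_exchange N (s : config N) (i j : 'I_N) : j = i.+1 :> nat ->
  word (exchange i j s) = take i (word s) ++ [:: s j, s i & drop i.+2 (word s)] :> seq bool.
Proof.
move=> ji; have nij : j != i by rewrite -val_eqE /= ji; lia.
have -> : s j = exchange i j s i by rewrite ffunE eqxx.
have -> : s i = exchange i j s j by rewrite ffunE eqxx (negbTE nij).
rewrite {1}(word_split2 _ ji); congr (_ ++ [:: _, _ & _]).
  apply: (@eq_from_nth _ false); rewrite !size_take !size_tuple// ltn_ord => k ki.
  rewrite !nth_take//; have kN := ltn_trans ki (ltn_ord i).
  rewrite !(nth_word _ (Ordinal kN)) ffunE -!val_eqE /=.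
  by case: eqP; [lia|case: eqP => //; lia].
apply: (@eq_from_nth _ false); rewrite !size_drop !size_tuple// => k ki.
rewrite !nth_drop; have kN : (i.+2 + k < N)%N by lia.
rewrite !(nth_word _ (Ordinal kN)) ffunE -!val_eqE /=.
by case: eqP; [lia|case: eqP => //; lia].
Qed.

Section Channels.
Variables (R : realType) (S I : finType).

(** A channel is a family of involutive jumps [e x].  An involution turns a sum over
the origins of jumps that end in [t] into a sum over channels. *)
Lemma channel_inflow (e : I -> S -> S) (A : pred I) (g : I -> S -> R) (f : S -> R) t :
  (forall x, involutive (e x)) ->
  \sum_s f s * (\sum_(x | A x && (t == e x s)) g x s) =
  \sum_(x | A x) f (e x t) * g x (e x t).
Proof.
move=> eK; under eq_bigr => s _.
  rewrite big_distrr big_mkcondr /=.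
  over.
rewrite exchange_big /=; apply: eq_bigr => x _.
rewrite -big_mkcond /= (big_pred1 (e x t)) // => s.
by rewrite /= -(inj_eq (inv_inj (eK x)) t) eK eq_sym.
Qed.

Lemma channel_outflow (e : I -> S) (A : pred I) (g : I -> R) :
  \sum_s \sum_(x | A x && (s == e x)) g x = \sum_(x | A x) g x.
Proof.
under eq_bigr => s _ do rewrite big_mkcondr /=.
rewrite exchange_big /=; apply: eq_bigr => x _.
by rewrite -big_mkcond /= (big_pred1 (e x)).
Qed.

End Channels.

Section Stationarity.
Variables (R : realType) (q alpha beta gamma delta : R).
Variable F : seq bool -> R.
Hypothesis F_bulk : forall w1 w2,
  F (w1 ++ [:: true, false & w2]) - q * F (w1 ++ [:: false, true & w2]) =
  (1 - q) * (F (w1 ++ true :: w2) + F (w1 ++ false :: w2)).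
Hypothesis F_left : forall w,
  alpha * F (false :: w) - gamma * F (true :: w) = (1 - q) * F w.
Hypothesis F_right : forall w,
  beta * F (rcons w true) - delta * F (rcons w false) = (1 - q) * F w.

Local Notation rate := (asep_rate alpha beta gamma delta q).

Definition hop_rate (x y : bool) : R :=
  if x && ~~ y then 1 else if ~~ x && y then q else 0.

(** The matrix product with the letter at site [n] deleted, with sign + for an empty
site and - for a particle: a discrete potential whose differences are, up to the
factor 1 - q, the net flows through the bonds. *)
Definition site_potential (w : seq bool) (n : nat) : R :=
  (if nth false w n then -1 else 1) * F (take n w ++ drop n.+1 w).

(** If the two sites differ, the bulk relation replaces the pair by either of its
letters.  If they agree, there is no flow, and deleting either of two equal
neighbouring letters gives the same word. *)
Lemma bond_balance N (t : config N) (i j : 'I_N) : j = i.+1 :> nat ->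
  F (word (exchange i j t)) * hop_rate (t j) (t i) - F (word t) * hop_rate (t i) (t j) =
  (1 - q) * (site_potential (word t) i - site_potential (word t) j).
Proof.
move=> ji; rewrite /site_potential !nth_word.
set w := word t; pose w1 := take i w; pose w2 := drop i.+2 w.
have -> : take i w ++ drop i.+1 w = w1 ++ t j :: w2.
  by rewrite -ji (drop_nth false) ?size_tuple// nth_word ji.
have -> : take j w ++ drop j.+1 w = w1 ++ t i :: w2.
  by rewrite ji (take_nth false) ?size_tuple// nth_word cat_rcons.
have -> : F w = F (w1 ++ [:: t i, t j & w2]) by rewrite {1}/w (word_split2 t ji).
rewrite (word_exchange _ ji) -/w -/w1 -/w2.
have /eqP := F_bulk w1 w2; rewrite subr_eq /hop_rate => /eqP h.
by case: (t i) (t j) => [] [] /=; rewrite ?h; ring.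
Qed.

(** The bond contributions telescope to a difference of the two end potentials,
each of which is cancelled by the reservoir at that end.  For a single site both
reservoirs act on it and the two potentials coincide. *)
Lemma channels_balance N (t : config N) :
  \sum_(p : 'I_N * 'I_N | p.2 == p.1.+1 :> nat)
    (F (word (exchange p.1 p.2 t)) * hop_rate (t p.2) (t p.1) -
     F (word t) * hop_rate (t p.1) (t p.2)) +
  \sum_(i < N | i == 0 :> nat)
    (F (word (flip i t)) * (if t i then alpha else gamma) -
     F (word t) * (if t i then gamma else alpha)) +
  \sum_(i < N | i.+1 == N)
    (F (word (flip i t)) * (if t i then delta else beta) -
     F (word t) * (if t i then beta else delta)) = 0.
Proof.
case: N t => [|n] t.
  rewrite [X in _ + X]big1 ?[X in _ + X + _]big1 ?big1 ?addr0//; do ?by case.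
  by case; case.
pose h := site_potential (word t).
have -> : \sum_(p : 'I_n.+1 * 'I_n.+1 | p.2 == p.1.+1 :> nat)
    (F (word (exchange p.1 p.2 t)) * hop_rate (t p.2) (t p.1) -
     F (word t) * hop_rate (t p.1) (t p.2)) = (1 - q) * (h 0 - h n).
  rewrite (eq_bigr (fun p : 'I_n.+1 * 'I_n.+1 => (1 - q) * (h p.1 - h p.2))); last first.
    by move=> [i j] /eqP ji; exact: bond_balance.
  rewrite -big_distrr /=; congr (_ * _).
  rewrite -(pair_big_dep xpredT (fun i j : 'I_n.+1 => j == i.+1 :> nat)
    (fun i j => h i - h j)) /= big_ord_recr /= [X in _ + X]big_pred0 ?addr0; last first.
    by move=> j; apply/negbTE; rewrite neq_ltn ltn_ord.
  rewrite -[RHS]opprB -(telescope_sumr h)// big_mkord -sumrN.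
  by apply: eq_bigr => i _; rewrite (big_pred1 (lift ord0 i)) ?opprB//.
rewrite [X in _ + X + _](big_pred1 (ord0 : 'I_n.+1)); last by move=> i; rewrite /= -val_eqE.
rewrite [X in _ + _ + X](big_pred1 (ord_max : 'I_n.+1)); last first.
  by move=> i; rewrite /= eqSS -val_eqE.
have -> : F (word (flip ord0 t)) * (if t ord0 then alpha else gamma) -
  F (word t) * (if t ord0 then gamma else alpha) = - ((1 - q) * h 0).
  set w' := drop 1 (word t).
  have -> : h 0 = (if t ord0 then -1 else 1) * F w'.
    by rewrite /h /site_potential (nth_word t ord0) take0.
  have -> : F (word t) = F (t ord0 :: w').
    by rewrite {1}(word_split t ord0) /= take0.
  rewrite word_flip /= take0 /= -/w' mulrCA -F_left.
  by case: (t ord0) => /=; ring.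
have -> : F (word (flip ord_max t)) * (if t ord_max then delta else beta) -
  F (word t) * (if t ord_max then beta else delta) = (1 - q) * h n.
  set w' := take n (word t).
  have -> : h n = (if t ord_max then -1 else 1) * F w'.
    by rewrite /h /site_potential (nth_word t ord_max) drop_oversize ?size_tuple// cats0.
  have -> : F (word t) = F (rcons w' (t ord_max)).
    by rewrite {1}(word_split t ord_max) drop_oversize ?size_tuple// cats1.
  rewrite word_flip drop_oversize ?size_tuple// cats1 -/w' mulrCA -F_right.
  by case: (t ord_max) => /=; ring.
ring.
Qed.

Lemma generator_balance N (f : config N -> R) t :
  \sum_s f s * asep_generator alpha beta gamma delta q s t =
  \sum_s f s * rate s t - f t * \sum_u rate t u.
Proof.
rewrite (bigD1 t)//= /asep_generator eqxx [in RHS](bigD1 t)//= [\sum_u _](bigD1 t)//=.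
rewrite [X in _ + X = _](eq_bigr (fun s => f s * rate s t)); last by move=> s /negbTE ->.
ring.
Qed.

Lemma rate_pairE N (s t : config N) : rate s t =
  \sum_(p : 'I_N * 'I_N | (p.2 == p.1.+1 :> nat) && (t == exchange p.1 p.2 s))
     hop_rate (s p.1) (s p.2) +
  \sum_(i < N | (i == 0 :> nat) && (t == flip i s)) (if s i then gamma else alpha) +
  \sum_(i < N | (i.+1 == N) && (t == flip i s)) (if s i then beta else delta).
Proof.
rewrite /asep_rate (pair_big_dep xpredT
  (fun i j : 'I_N => (j == i.+1 :> nat) && (t == exchange i j s))
  (fun i j => hop_rate (s i) (s j))) /=.
by [].
Qed.

(** The equation is regrouped by channels, bonds and reservoirs, each of which
connects [t] with a single other configuration. *)
Lemma matrix_product_stationary N (t : config N) :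
  \sum_s F (word s) * asep_generator alpha beta gamma delta q s t = 0.
Proof.
rewrite (generator_balance (fun s => F (word s))).
under eq_bigr => s _ do rewrite rate_pairE !mulrDr.
under [X in _ * X]eq_bigr => s _ do rewrite rate_pairE.
rewrite !big_split /=.
rewrite (channel_inflow (fun p : 'I_N * 'I_N => p.2 == p.1.+1 :> nat)
  (fun p (s : config N) => hop_rate (s p.1) (s p.2)) (fun s : config N => F (word s)) t
  (fun p : 'I_N * 'I_N => exchangeK p.1 p.2)).
rewrite (channel_inflow (fun i : 'I_N => i == 0 :> nat)
  (fun i (s : config N) => if s i then gamma else alpha)
  (fun s : config N => F (word s)) t (@flipK N)).
rewrite (channel_inflow (fun i : 'I_N => i.+1 == N)
  (fun i (s : config N) => if s i then beta else delta)
  (fun s : config N => F (word s)) t (@flipK N)).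
rewrite (channel_outflow (fun p : 'I_N * 'I_N => exchange p.1 p.2 t)
  (fun p : 'I_N * 'I_N => p.2 == p.1.+1 :> nat) (fun p => hop_rate (t p.1) (t p.2))).
rewrite !(channel_outflow (fun i : 'I_N => flip i t)).
rewrite -[RHS](channels_balance t) !sumrB -!big_distrr /= !mulrDr.
have -> : \sum_(p : 'I_N * 'I_N | p.2 == p.1.+1 :> nat)
   F (word (exchange p.1 p.2 t)) * hop_rate (exchange p.1 p.2 t p.1) (exchange p.1 p.2 t p.2) =
  \sum_(p : 'I_N * 'I_N | p.2 == p.1.+1 :> nat)
   F (word (exchange p.1 p.2 t)) * hop_rate (t p.2) (t p.1).
  apply: eq_bigr => -[i j] /= /eqP ji; rewrite !ffunE !eqxx.
  by have -> : (j == i) = false by rewrite -val_eqE /= ji; lia.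
have E (A : pred 'I_N) (x y : R) :
    \sum_(i | A i) F (word (flip i t)) * (if flip i t i then x else y) =
    \sum_(i | A i) F (word (flip i t)) * (if t i then y else x).
  by apply: eq_bigr => i _; rewrite ffunE eqxx; case: (t i).
rewrite !E; ring.
Qed.

End Stationarity.

(** * Uniqueness of the stationary law *)

Section Uniqueness.
Variables (R : realType) (S : finType) (r : S -> S -> R).
Hypothesis r_ge0 : forall s t, 0 <= r s t.

(** Both sums run over all states, since the diagonal of [r] contributes the same
term to the two sides. *)
Definition balanced (f : S -> R) :=
  forall t, \sum_s f s * r s t = f t * \sum_u r t u.

Variable p : S -> R.
Hypotheses (p_gt0 : forall s, 0 < p s) (p_balanced : balanced p).
Variable s0 : S.
Hypothesis reach : forall P : S -> Prop, (forall s t, P t -> 0 < r s t -> P s) ->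
  forall t, P t -> P s0.

(** Maximum principle for [h = f / p].  Subtracting the balance equations of [f] and
of [p] at a maximum [t] of [h] gives that the nonnegative numbers
[p u * r u t * (h t - h u)] sum to 0, so every predecessor of [t] is a maximum
too, and finally the root [s0] is one. *)
Lemma balanced_max_root f : balanced f -> forall t, f t / p t <= f s0 / p s0.
Proof.
move=> fb t; pose h s := f s / p s.
have fE s : f s = p s * h s by rewrite /h mulrC divfK// gt_eqF.
pose m := [arg max_(i > s0) h i]%O.
have hm s : h s <= h m.
  by rewrite /m; case: arg_maxP => // i _ /(_ s isT).
suff -> : f s0 / p s0 = h m by exact: hm.
apply: (@reach (fun s => h s = h m) _ m erefl) => s {}t ht rst.
have : \sum_u p u * r u t * (h t - h u) = 0.
  under eq_bigr => u _ do rewrite mulrBr mulrAC.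
  rewrite sumrB [X in _ - X](eq_bigr (fun u => f u * r u t)); last first.
    by move=> u _; rewrite fE; ring.
  rewrite fb fE; under eq_bigr => u _ do rewrite mulrAC mulrC.
  by rewrite -big_distrr /= p_balanced; ring.
move/eqP; rewrite psumr_eq0; last first.
  by move=> u _; rewrite !mulr_ge0 ?(ltW (p_gt0 u))// subr_ge0 ht.
move=> /allP/(_ s (mem_index_enum s)) /=.
by rewrite !mulf_eq0 (gt_eqF (p_gt0 s)) (gt_eqF rst) /= subr_eq0 ht => /eqP.
Qed.

(** The maximum principle for both [f] and [- f]: the ratio at the root is its
maximum and its minimum. *)
Lemma balanced_proportional f : balanced f -> forall t, f t / p t = f s0 / p s0.
Proof.
move=> fb t; apply/le_anti; rewrite balanced_max_root//=.
have /balanced_max_root/(_ t) : balanced (fun s => - f s).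
  by move=> u; under eq_bigr => s _ do rewrite mulNr; rewrite sumrN fb mulNr.
by rewrite !mulNr lerN2.
Qed.

Lemma balanced_unique f : balanced f -> \sum_s f s = \sum_s p s -> f =1 p.
Proof.
move=> fb fp s; pose k := f s0 / p s0.
have fE t : f t = k * p t by rewrite /k -(balanced_proportional fb t) divfK// gt_eqF.
have k1 : k = 1.
  move: fp; under eq_bigr => t _ do rewrite fE.
  have P0 : \sum_s p s != 0.
    rewrite gt_eqF// (bigD1 s0)//= ltr_pwDl// sumr_ge0// => u _; exact: ltW.
  by rewrite -big_distrr /= -[RHS]mul1r => /(mulIf P0).
by rewrite fE k1 mul1r.
Qed.
End Uniqueness.

Section Reach.
Variables (R : realType) (N : nat) (q alpha beta gamma delta : R).
Hypotheses (q_ge0 : 0 <= q) (alpha_gt0 : 0 < alpha) (beta_ge0 : 0 <= beta).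
Hypotheses (gamma_ge0 : 0 <= gamma) (delta_ge0 : 0 <= delta).

Local Notation rate := (@asep_rate R N alpha beta gamma delta q).

Lemma asep_rate_ge0 s t : 0 <= rate s t.
Proof.
by rewrite !addr_ge0//; apply: sumr_ge0 => i _; [apply: sumr_ge0 => j _| |];
  do ![case: ifP => // _]; rewrite ltW.
Qed.

Lemma asep_rate_hop (s : config N) (i j : 'I_N) : j = i.+1 :> nat -> s i -> ~~ s j ->
  0 < rate s (exchange i j s).
Proof.
move=> ji si sj; rewrite rate_pairE -addrA ltr_pwDl//.
  rewrite (bigD1 (i, j))/=; last by rewrite ji !eqxx.
  rewrite ltr_pwDl//; first by rewrite /hop_rate si sj.
  by apply: sumr_ge0 => x _; rewrite /hop_rate; do ![case: ifP => // _].
by rewrite addr_ge0// sumr_ge0// => x _; case: ifP => // _; rewrite ltW.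
Qed.

Lemma asep_rate_enter (s : config N) (i : 'I_N) : i = 0 :> nat -> ~~ s i -> 0 < rate s (flip i s).
Proof.
move=> i0 si; rewrite /asep_rate addrAC ltr_wpDl//.
  rewrite addr_ge0// sumr_ge0// => x _; last by case: ifP.
  by rewrite sumr_ge0// => y _; do ![case: ifP => // _].
rewrite (bigD1 i)/=; last by rewrite i0 !eqxx.
rewrite ltr_pwDl ?(negbTE si)// sumr_ge0// => x _.
by case: ifP => // _; rewrite ltW.
Qed.

(** Decreases along backward jumps in which particles hop to the left or leave at
the first site. *)
Definition energy (t : config N) : nat := \sum_(i < N) t i * i.+1.

Lemma energy_flip (t : config N) i : t i -> (energy (flip i t) < energy t)%N.
Proof.
move=> ti; rewrite /energy !(bigD1 i (P := xpredT))//= ffunE eqxx ti.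
rewrite (eq_bigr (fun k : 'I_N => t k * k.+1)%N); first by lia.
by move=> k /negbTE ki; rewrite ffunE ki.
Qed.

Lemma energy_exchange (t : config N) (i j : 'I_N) : (i < j)%N -> ~~ t i -> t j ->
  (energy (exchange i j t) < energy t)%N.
Proof.
move=> ij ti tj; have nij : j != i by rewrite -val_eqE /=; lia.
rewrite /energy !(bigD1 i (P := xpredT))//= !(bigD1 j (P := fun k => k != i))//=.
rewrite !ffunE !eqxx (negbTE nij) tj (negbTE ti).
rewrite (eq_bigr (fun k : 'I_N => t k * k.+1)%N); first by lia.
by move=> k /andP[/negbTE ki /negbTE kj]; rewrite ffunE ki kj.
Qed.

(** Backward reachability uses only two kinds of forward jumps, which have
positive rates for all parameters: the hop of a particle to the right and the
entrance of a particle at the first site.  Reading them backwards, the first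
particle moves to the left end and disappears there. *)
Lemma asep_reach_empty (P : config N -> Prop) :
  (forall s t, P t -> 0 < rate s t -> P s) -> forall t, P t -> P [ffun=> false].
Proof.
move=> closed t; have [n] := ubnP (energy t).
elim: n t => // n IH t; rewrite ltnS => tn Pt.
have [/existsP[i0 ti0]|/existsPn t0] := boolP [exists i, t i]; last first.
  suff -> : [ffun=> false] = t by [].
  by apply/ffunP => i; rewrite ffunE (negbTE (t0 i)).
(* the leftmost particle *)
pose i := [arg min_(i < i0 | t i) nat_of_ord i].
have [ti imin] : t i /\ forall j, t j -> (i <= j)%N.
  by rewrite /i; case: arg_minnP.
have [i_eq0|i_gt0] := posnP i.
  apply: (IH (flip i t)).
    by apply: leq_trans tn; exact: energy_flip.
  apply: closed Pt _; rewrite -{2}(flipK i t).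
  by apply: asep_rate_enter => //; rewrite ffunE eqxx ti.
have kN : (i.-1 < N)%N by have := ltn_ord i; lia.
pose k := Ordinal kN.
have ik : i = k.+1 :> nat by rewrite /= prednK.
have tk : ~~ t k by apply/negP => /imin; lia.
apply: (IH (exchange k i t)).
  by apply: leq_trans tn; apply: energy_exchange => //; lia.
apply: closed Pt _; rewrite -{2}(exchangeK k i t).
have nik : (i == k) = false by rewrite -val_eqE /=; lia.
by apply: asep_rate_hop; rewrite // ffunE ?nik eqxx.
Qed.

End Reach.

(** * Lattice paths and the walk of the gap *)

Section Paths.
Variable N : nat.

(** The path with initial value [x] and increments read off a word. *)
Definition path_of (x : int) (w : seq bool) : lattice_path N :=
  [ffun j : 'I_N.+1 => x + \sum_(i < j) (nth false w i)%:Z].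

Definition steps (p : lattice_path N) : config N := [ffun i => path_step p i == 1].

Lemma path_step_of x w (i : 'I_N) : path_step (path_of x w) i = nth false w i.
Proof. by rewrite /path_step !ffunE lift0 big_ord_recr /=; ring. Qed.

Lemma path_of0 x w : path_of x w ord0 = x.
Proof. by rewrite ffunE big_ord0 addr0. Qed.

Lemma word_inj : injective (@word N).
Proof. by move=> s t st; apply/ffunP => i; rewrite -!nth_word st. Qed.

Lemma steps_path_of x (w : N.-tuple bool) : word (steps (path_of x w)) = w.
Proof.
apply: eq_from_tnth => i; rewrite !(tnth_nth false) nth_word ffunE path_step_of.
by case: (nth _ _ _).
Qed.

Lemma path_of_steps (p : lattice_path N) :
  [forall i, path_step p i \in [:: 0; 1]] -> p = path_of (p ord0) (word (steps p)).
Proof.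
move=> /forallP hp; apply/ffunP => -[n nN]; rewrite ffunE /=.
elim: n nN => [|n IH] nN; first by rewrite big_ord0 addr0; congr (p _); exact: val_inj.
have nN' : (n < N)%N by [].
pose i := Ordinal nN'.
have -> : Ordinal nN = lift ord0 i by apply: val_inj.
rewrite -[p _](subrK (p (widen_ord (leqnSn N) i))) -/(path_step p i).
have -> : widen_ord (leqnSn N) i = Ordinal (ltnW nN) by exact: val_inj.
rewrite IH big_ord_recr /= (nth_word (steps p) i) ffunE.
have -> : (path_step p i == 1)%:Z = path_step p i.
  by have := hp i; rewrite !inE => /orP[] /eqP ->.
by move: (path_step p i) => z; ring.
Qed.

Lemma height_path_of (s : config N) : height s = path_of 0 (word s).
Proof.
apply/ffunP => j; rewrite !ffunE add0r.
rewrite (big_ord_widen N (fun i => (nth false (word s) i)%:Z)); last by rewrite -ltnS.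
rewrite -natz natr_sum; apply: eq_bigr => i _.
by rewrite nth_word natz.
Qed.

End Paths.

Section GapWalk.
Variables (R : realType) (q b c d : R).
Local Notation right_vector := (right_vector q b c d).
Local Notation lw := (local_weight q c d).

(** The gap after a step with increments [x] of the upper and [y] of the lower
path, or [None] if the paths cross. *)
Definition gap_step (k : nat) (x y : bool) : option nat :=
  match x, y with
  | true, false => Some k.+1
  | false, true => if k is j.+1 then Some j else None
  | _, _ => Some k
  end.

(** The contribution of a second layer [v] to the matrix product of [w], by recursion
along the words.  It vanishes as soon as the layers cross. *)
Fixpoint path_weight (w v : seq bool) (k : nat) : R :=
  match w, v with
  | x :: w', y :: v' =>
      if gap_step k x y is Some k' then lw k' x y * path_weight w' v' k' else 0
  | _, _ => right_vector k
  end.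

(** The gap as an integer, without the condition that the layers do not cross. *)
Definition signed_gap (k : int) (w v : seq bool) (j : nat) : int :=
  k + \sum_(i < j) ((nth false w i)%:Z - (nth false v i)%:Z).

Lemma signed_gap_cons k x y w v j :
  signed_gap k (x :: w) (y :: v) j.+1 = signed_gap (k + x%:Z - y%:Z) w v j.
Proof. by rewrite /signed_gap big_ord_recl /= !addrA. Qed.

Lemma path_weightE n w v (k : nat) : size w = n -> size v = n ->
  (forall j, (j <= n)%N -> 0 <= signed_gap k w v j) ->
  path_weight w v k = right_vector `|signed_gap k w v n| *
    \prod_(i < n) lw `|signed_gap k w v i.+1| (nth false w i) (nth false v i).
Proof.
elim: n w v k => [|n IH] [|x w] [|y v] k //=.
  by rewrite big_ord0 mulr1 /signed_gap big_ord0 addr0.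
move=> [szw] [szv] adm; rewrite big_ord_recl signed_gap_cons [X in lw _ X _]/= [X in lw _ _ X]/=.
under eq_bigr => i _ do rewrite lift0 signed_gap_cons [X in lw _ X _]/= [X in lw _ _ X]/=.
have {}adm j : (j <= n)%N -> 0 <= signed_gap (k%:Z + x%:Z - y%:Z) w v j.
  by move=> jw; rewrite -signed_gap_cons; apply: adm.
have k0 : 0 <= k%:Z + x%:Z - y%:Z by have := adm 0 isT; rewrite /signed_gap big_ord0 addr0.
have -> : gap_step k x y = Some `|(k%:Z + x%:Z - y%:Z)%R|%N.
  by case: x y {adm} k0 => [] [] /=; try case: k => [|k] //=; move=> _; congr Some; lia.
set k' := absz _; have k'E : k%:Z + x%:Z - y%:Z = k'%:Z by rewrite /k' gez0_abs.
rewrite k'E in adm *.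
rewrite IH// mulrCA; congr (_ * (_ * _)).
by rewrite signed_gap_cons k'E /signed_gap [nat_of_ord ord0]/= big_ord0 addr0.
Qed.

(** Crossing layers have weight 0, so the sums over second layers may run over all
words. *)
Lemma path_weight_neq0 w v (k : nat) : size v = size w -> path_weight w v k != 0 ->
  forall j, (j <= size w)%N -> 0 <= signed_gap k w v j.
Proof.
elim: w v k => [|x w IH] [|y v] k //=.
  by move=> _ _ j _; rewrite /signed_gap addr_ge0// sumr_ge0// => i _; rewrite !nth_nil.
move=> [sz]; case E : (gap_step k x y) => [k'|]; last by rewrite eqxx.
rewrite mulf_eq0 negb_or => /andP[_ /(IH _ _ sz) adm] [_|j jw].
  by rewrite /signed_gap big_ord0 addr0.
rewrite signed_gap_cons; have -> : k%:Z + x%:Z - y%:Z = k'%:Z; last exact: adm.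
by case: x y E => [] [] /=; try case: k => [|k] //=; move=> [<-]; lia.
Qed.

Lemma transfer_gap_step x u k : transfer q c d x u k =
  \sum_y (if gap_step k x y is Some k' then lw k' x y * u k' else 0).
Proof. by rewrite big_bool /transfer; case: x => //=; rewrite addrC; case: k. Qed.

Lemma big_tuple_cons n (f : n.+1.-tuple bool -> R) :
  \sum_v f v = \sum_y \sum_(v : n.-tuple bool) f [tuple of y :: v].
Proof.
rewrite pair_big /=; apply: (reindex (fun p : bool * n.-tuple bool => [tuple of p.1 :: p.2])).
exists (fun v => (thead v, [tuple of behead v])) => [[y v] _|v _] /=.
  by congr (_, _); apply: val_inj.
by rewrite -tuple_eta.
Qed.

(** Expansion of the matrix product: the intermediate indices of the product are the
values of the gap. *)
Lemma sum_path_weight n (w : seq bool) k : size w = n ->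
  \sum_(v : n.-tuple bool) path_weight w v k = word_vector q b c d w k.
Proof.
elim: n w k => [|n IH] [|x w] k //=.
  by rewrite (big_pred1 [tuple]) //= => v; rewrite [v]tuple0; apply/esym/eqP.
move=> [sz]; rewrite big_tuple_cons transfer_gap_step; apply: eq_bigr => y _ /=.
case: gap_step => [k'|]; last by rewrite big1.
by rewrite -big_distrr /= IH.
Qed.

End GapWalk.

(** * Summing out the second layer *)

Section Encoding.
Variable N : nat.
Implicit Types (l : two_layer N) (s : config N) (v : N.-tuple bool) (k : nat).

(** The first layer starts at 0, so the initial gap and the increments of the second
layer determine the latter. *)
Definition encode l : config N * (nat * N.-tuple bool) :=
  (steps (layer1 l), (gap l ord0, word (steps (layer2 l)))).

Definition admissible s k v :=
  forall j, (j <= N)%N -> 0 <= signed_gap k (word s) v j.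

Lemma two_layer_order l j : layer2 l j <= layer1 l j.
Proof. by have /and4P[_ /forallP/(_ j)] := two_layerP l. Qed.

Lemma gapE l j : (gap l j)%:Z = layer1 l j - layer2 l j.
Proof. by rewrite /gap gez0_abs// subr_ge0 two_layer_order. Qed.

Lemma layer1_head l : layer1 l ord0 = 0.
Proof. by have /and4P[/eqP] := two_layerP l. Qed.

Lemma layer1E l : layer1 l = height (steps (layer1 l)).
Proof.
rewrite height_path_of -[0](layer1_head l); apply: path_of_steps.
by have /and4P[] := two_layerP l.
Qed.

Lemma layer2E l : layer2 l = path_of N (- (gap l ord0)%:Z) (word (steps (layer2 l))).
Proof.
rewrite gapE layer1_head sub0r opprK; apply: path_of_steps.
by have /and4P[] := two_layerP l.
Qed.

Lemma path_of_sub k (w v : seq bool) (j : 'I_N.+1) :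
  path_of N 0 w j - path_of N (- k%:Z) v j = signed_gap k w v j.
Proof. by rewrite !ffunE /signed_gap sumrB; ring. Qed.

Lemma gap_signed l j : (gap l j)%:Z =
  signed_gap (gap l ord0) (word (steps (layer1 l))) (word (steps (layer2 l))) j.
Proof. by rewrite -path_of_sub -height_path_of -layer1E -layer2E gapE. Qed.

Lemma admissible_encode l :
  admissible (steps (layer1 l)) (gap l ord0) (word (steps (layer2 l))).
Proof.
by move=> j jN; have := gap_signed l (Ordinal (jN : (j < N.+1)%N)) => /= <-.
Qed.

Lemma admissible_decode s k v : admissible s k v ->
  is_two_layer (height s, path_of N (- k%:Z) v).
Proof.
move=> adm; rewrite height_path_of /is_two_layer /= path_of0 eqxx /=.
apply/and3P; split; apply/forallP => i.
- by rewrite -subr_ge0 path_of_sub; apply: adm; rewrite -ltnS.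
- by rewrite path_step_of; case: (nth _ _ _).
- by rewrite path_step_of; case: (nth _ _ _).
Qed.

(** Allowing an arbitrary set of first layers makes the reindexing apply to the total
mass and to the marginal alike. *)
Lemma encode_bij (B : set (lattice_path N)) :
  set_bij (@layer1 N @^-1` B)
    ((@height N @^-1` B) `*`` (fun s => [set kv | admissible s kv.1 kv.2])) encode.
Proof.
split=> [l /= Bl|l l' _ _ E|[s [k v]] /= [Bs adm]].
- by split => /=; [rewrite -layer1E|exact: admissible_encode].
- have /= E1 := congr1 fst E; have /= E0 := congr1 (fst \o snd) E.
  have /= E2 := congr1 (snd \o snd) E.
  apply: val_inj; apply: injective_projections.
    by rewrite -!/(layer1 _) (layer1E l) E1 -layer1E.
  by rewrite -!/(layer2 _) (layer2E l) E0 E2 -layer2E.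
- exists (TwoLayer (admissible_decode adm)) => //.
  have w1 : steps (height s) = s.
    by apply: word_inj; rewrite height_path_of steps_path_of.
  rewrite /encode /= /layer1 /layer2 /= w1 steps_path_of; congr (_, (_, _)).
  by rewrite /gap /layer1 /layer2 /= height_path_of !path_of0 opprK add0r.
Qed.

End Encoding.

Lemma esum_finType (R : realType) (T : finType) (A : set T) (f : T -> R) :
  (forall x, 0 <= f x) -> \esum_(x in A) (f x)%:E = (\sum_(x | x \in A) f x)%:E.
Proof.
move=> f0; rewrite esum_fset; [|exact: finite_finset|by move=> x _; rewrite lee_fin].
rewrite -sumEFin [RHS]bigfs ?index_enum_uniq//; last by move=> x _; rewrite mem_index_enum.
by rewrite set_mem_set.
Qed.

Section Marginal.
Variables (R : realType) (q a b c d : R) (N : nat).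
Hypotheses (hq : 0 <= q < 1) (ha : 0 <= a) (hb : 0 <= b).
Hypotheses (hc : -1 < c <= 0) (hd : -1 < d <= 0) (hab : a * b < 1).
Local Notation wt := (@two_layer_wt R N q a b c d).
Local Notation word_weight := (word_weight q a b c d).

Lemma two_layer_wtE (l : two_layer N) : wt l = a ^+ gap l ord0 *
  path_weight q b c d (word (steps (layer1 l))) (word (steps (layer2 l))) (gap l ord0).
Proof.
have adm := admissible_encode l.
have gE j (jN : (j < N.+1)%N) : gap l (Ordinal jN) = `|signed_gap (gap l ord0)
    (word (steps (layer1 l))) (word (steps (layer2 l))) j|%N.
  by rewrite -[LHS]/(`|(gap l (Ordinal jN))%:Z|%N) gap_signed.
rewrite (@path_weightE _ _ _ _ _ N) ?size_tuple//.
rewrite /two_layer_wt /right_vector -!mulrA; congr (_ * _).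
rewrite -(gE N (ltnSn N)); have -> : Ordinal (ltnSn N) = ord_max by exact: val_inj.
do 3!congr (_ * _); apply: eq_bigr => i _.
rewrite !nth_word !ffunE; congr local_weight.
have -> : lift ord0 i = Ordinal (ltn_ord i : (i.+1 < N.+1)%N) by exact: val_inj.
exact: gE.
Qed.

Lemma path_weight_ge0 w v k : 0 <= path_weight q b c d w v k.
Proof.
elim: w v k => [|x w IH] [|y v] k /=; do ?exact: right_vector_ge0.
by case: gap_step => // k'; rewrite mulr_ge0// local_weight_ge0.
Qed.

Lemma two_layer_wt_ge0 l : 0 <= wt l.
Proof. by rewrite two_layer_wtE mulr_ge0 ?exprn_ge0// path_weight_ge0. Qed.

(** The series over the initial gap is the pairing with W, and the finite sum over
second layers expands the product of the matrices with V. *)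
Lemma fiber_esum (s : config N) :
  \esum_(kv in [set kv : nat * N.-tuple bool | admissible s kv.1 kv.2])
     (a ^+ kv.1 * path_weight q b c d (word s) kv.2 kv.1)%:E = (word_weight (word s))%:E.
Proof.
rewrite esum_mkcond.
have := @esum_esum R nat (N.-tuple bool) setT (fun=> setT)
  (fun k v => (a ^+ k * path_weight q b c d (word s) v k)%:E).
rewrite (_ : [set: nat] `*`` (fun=> setT) = setT); last by apply/seteqP; split.
have wge0 k v : (0 <= (a ^+ k * path_weight q b c d (word s) v k)%:E)%E.
  by rewrite lee_fin mulr_ge0 ?exprn_ge0// path_weight_ge0.
move=> /(_ (fun _ _ _ _ => wge0 _ _)) E.
transitivity (\esum_(kv in [set: nat * N.-tuple bool])
   (a ^+ kv.1 * path_weight q b c d (word s) kv.2 kv.1)%:E).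
  apply: eq_esum => -[k v] _ /=; case: ifPn => //; rewrite notin_setE /= => nadm.
  have [->|nz] := eqVneq (path_weight q b c d (word s) v k) 0; first by rewrite mulr0.
  exfalso; apply: nadm => j jN.
  by apply: (path_weight_neq0 _ nz); rewrite ?size_tuple.
rewrite -E /word_weight.
rewrite -(pairing_esum ha (growth_rate_gt0 ha hb hab) (a_growth_rate_lt1 ha hab)); first last.
- by move=> k; exact: word_vector_ge0.
- exact: word_vector_geo_bounded.
apply: eq_esum => k _; rewrite esum_finType; last by move=> v; rewrite -lee_fin.
rewrite (eq_bigl xpredT); last by move=> v; rewrite in_setT.
by rewrite -(sum_path_weight q b c d k (size_tuple (word s))) big_distrr.
Qed.

(** The marginal of the unnormalized two-layer measure on the first layer, tested on
an arbitrary set of paths. *)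
Lemma two_layer_esum (B : set (lattice_path N)) :
  \esum_(l in @layer1 N @^-1` B) (wt l)%:E =
  \esum_(s in @height N @^-1` B) (word_weight (word s))%:E.
Proof.
under [RHS]eq_esum => s _ do rewrite -fiber_esum.
rewrite esum_esum; last first.
  by move=> s kv _ _; rewrite lee_fin mulr_ge0 ?exprn_ge0// path_weight_ge0.
rewrite (reindex_esum _ _ _ _ (encode_bij B)).
by apply: eq_esum => l _; rewrite two_layer_wtE.
Qed.

End Marginal.

(** * Probability measures and the parameters of the process *)

Section WeightedMeasure.
Context d (T : measurableType d) (R : realType) (f : T -> R).
Hypothesis f_ge0 : forall x, 0 <= f x.

(** The proof of nonnegativity is an argument in order that the measure structure can
be attached to the function itself. *)
Definition mass (_ : forall x, 0 <= f x) (A : set T) : \bar R := \esum_(x in A) (f x)%:E.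

Let mass0 : mass f_ge0 set0 = 0%E.
Proof. exact: esum_set0. Qed.

Let mass_ge0 A : (0 <= mass f_ge0 A)%E.
Proof. by apply: esum_ge0 => x _; rewrite lee_fin. Qed.

Let mass_sigma_additive : semi_sigma_additive (mass f_ge0).
Proof.
move=> F _ tF _.
have -> : mass f_ge0 (\bigcup_n F n) = (\sum_(n <oo) mass f_ge0 (F n))%E.
  rewrite nneseries_esumT; last by move=> n; exact: mass_ge0.
  by apply: esum_bigcupT => // x; rewrite lee_fin.
by apply: is_cvg_nneseries => n _ _; exact: mass_ge0.
Qed.

HB.instance Definition _ :=
  isMeasure.Build _ _ _ (mass f_ge0) mass0 mass_ge0 mass_sigma_additive.

Lemma weighted_probability (Z : R) : \esum_(x in [set: T]) (f x)%:E = Z%:E -> 0 < Z ->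
  exists P : probability T R,
    forall A, P A = ((\esum_(x in A) (f x)%:E) * (Z^-1)%:E)%E.
Proof.
move=> fZ Z0; exists (mnormalize (mass f_ge0) \d_point) => A.
have mZ : (mass f_ge0 : {measure set T -> \bar R}) [set: T] = Z%:E by exact: fZ.
by rewrite /= /mnormalize mZ orbF eqe gt_eqF.
Qed.

End WeightedMeasure.

Lemma probability_config (R : realType) N (mu : probability (config N) R)
    (A : set (config N)) : mu A = \esum_(s in A) (fine (mu [set s]))%:E.
Proof.
have mE s : (fine (mu [set s]))%:E = mu [set s] by rewrite fineK// fin_num_measure.
under eq_esum => s _ do rewrite mE.
rewrite esum_fset; [|exact: finite_finset|by []].
rewrite -measure_fin_bigcup; [|exact: finite_finset| |by []].
  by rewrite bigcup_imset1 image_id.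
by move=> s t _ _ [u [/= -> ->]].
Qed.

Section BoundaryRates.
Variables (R : realType) (q : R).

(** The numbers [phi_plus q x y] and [phi_minus q x y] are the roots of
[x z^2 - (1 - q - x + y) z - y]; their sum and product give both relations. *)
Lemma phi_relations (x y : R) : 0 < x -> 0 <= y ->
  (1 + phi_plus q x y) * (1 + phi_minus q x y) * x = 1 - q /\
  y = - (phi_plus q x y * phi_minus q x y * x).
Proof.
move=> x0 y0; rewrite /phi_plus /phi_minus.
set D := _ ^+ 2 + _; set S := Num.sqrt D; set B := 1 - q - x + y in D S *.
have D0 : 0 <= D by rewrite addr_ge0 ?sqr_ge0// !mulr_ge0// ltW.
have SE : S ^+ 2 = B ^+ 2 + 4 * x * y by rewrite sqr_sqrtr.
have x1 : x != 0 by rewrite gt_eqF.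
have prod : ((2 * x)^-1 * (B + S)) * ((2 * x)^-1 * (B - S)) = - y / x.
  transitivity ((2 * x)^-1 ^+ 2 * (B ^+ 2 - S ^+ 2)); first by ring.
  by rewrite SE; field; rewrite x1.
have sum : (2 * x)^-1 * (B + S) + (2 * x)^-1 * (B - S) = B / x by field.
split; last by rewrite prod; field.
move: sum prod; set P := _ * (B + S); set M := _ * (B - S) => sum prod.
transitivity ((1 + (P + M) + P * M) * x); first by ring.
by rewrite sum prod /B; field.
Qed.

(** At these rates the discriminant is the square of [x (a - c)], and [a - c] is
nonnegative. *)
Lemma phi_inverse (a c x : R) : 0 < x -> 0 <= a -> c <= 0 -> (1 + a) * (1 + c) * x = 1 - q ->
  phi_plus q x (- (a * c * x)) = a /\ phi_minus q x (- (a * c * x)) = c.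
Proof.
move=> x0 a0 c0 xE; rewrite /phi_plus /phi_minus.
have -> : 1 - q - x - a * c * x = x * (a + c) by rewrite -xE; ring.
have -> : (x * (a + c)) ^+ 2 + 4 * x * - (a * c * x) = (x * (a - c)) ^+ 2 by ring.
rewrite sqrtr_sqr ger0_norm; last by rewrite mulr_ge0 ?(ltW x0)// subr_ge0 (le_trans c0).
by split; field; rewrite gt_eqF.
Qed.

End BoundaryRates.

Section StationaryMeasure.
Variables (R : realType) (N : nat) (q a b c d : R).
Hypotheses (hq : 0 <= q < 1) (ha : 0 <= a) (hb : 0 <= b).
Hypotheses (hc : -1 < c <= 0) (hd : -1 < d <= 0) (hab : a * b < 1).

Lemma boundary_rates (x y : R) : 0 <= x -> -1 < y <= 0 ->
  exists r : R, [/\ 0 < r, (1 + x) * (1 + y) * r = 1 - q & 0 <= - (x * y * r)].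
Proof.
move=> x0 /andP[y1 y0]; exists ((1 - q) / ((1 + x) * (1 + y))).
have X : 0 < (1 + x) * (1 + y) by apply: mulr_gt0; lra.
have r0 : 0 < (1 - q) / ((1 + x) * (1 + y)).
  by rewrite divr_gt0// subr_gt0; case/andP: hq.
split=> //; first by rewrite mulrC divfK// gt_eqF.
by rewrite -mulNr mulr_ge0 ?(ltW r0)// -mulrN mulr_ge0// oppr_ge0.
Qed.

Lemma asep_parameters_exist :
  exists alpha beta gamma delta : R, asep_parameters q a b c d alpha beta gamma delta.
Proof.
have [alpha [al0 alE ga0]] := boundary_rates ha hc.
have [beta [be0 beE de0]] := boundary_rates hb hd.
have [pa pc] := phi_inverse al0 ha (proj2 (andP hc)) alE.
have [pb pd] := phi_inverse be0 hb (proj2 (andP hd)) beE.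
exists alpha, beta, (- (a * c * alpha)), (- (b * d * beta)).
by split.
Qed.

Local Notation F := (fun s : config N => word_weight q a b c d (word s)).

Section Rates.
Variables (alpha beta gamma delta : R).
Hypothesis hpar : asep_parameters q a b c d alpha beta gamma delta.

(** The relations of [phi_relations] turn the two boundary identities of the matrix
product into the balance between entrance and removal at each reservoir. *)
Lemma word_weight_balanced : balanced (@asep_rate R N alpha beta gamma delta q) F.
Proof.
move: hpar => [[al0 be0 ga0 de0] Ea Eb Ec Ed] t.
have := phi_relations q al0 ga0; rewrite -Ea -Ec => -[alE gaE].
have := phi_relations q be0 de0; rewrite -Eb -Ed => -[beE deE].
apply/eqP; rewrite -subr_eq0; apply/eqP.
rewrite -[LHS](generator_balance q alpha beta gamma delta F).
apply: (@matrix_product_stationary _ _ _ _ _ _ (word_weight q a b c d)).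
- exact: word_weight_bulk.
- move=> w; rewrite gaE -alE.
  transitivity (((1 + a) * (1 + c) * word_weight q a b c d w) * alpha); last by ring.
  by rewrite -word_weight_left//; ring.
- move=> w; rewrite deE -beE.
  transitivity (((1 + b) * (1 + d) * word_weight q a b c d w) * beta); last by ring.
  by rewrite -word_weight_right//; ring.
Qed.

Lemma stationary_balanced (mu : probability (config N) R) :
  asep_stationary alpha beta gamma delta q mu <->
  balanced (@asep_rate R N alpha beta gamma delta q) (fun s => fine (mu [set s])).
Proof.
split=> h t; last by rewrite generator_balance h subrr.
by apply/eqP; rewrite -subr_eq0 -generator_balance h.
Qed.

End Rates.

Definition normalization : R := \sum_s F s.
Local Notation Z := normalization.

Lemma normalization_gt0 : 0 < Z.
Proof.
have F0 s : 0 < F s by exact: word_weight_gt0.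
rewrite /normalization (bigD1 [ffun=> false])//= ltr_pwDl//; first exact: F0.
by apply: sumr_ge0 => s _; exact/ltW/F0.
Qed.

Lemma esum_word_weight : \esum_(s in [set: config N]) (F s)%:E = Z%:E.
Proof.
rewrite esum_finType; last by move=> s; rewrite ltW// word_weight_gt0.
by congr EFin; apply: eq_bigl => s; rewrite in_setT.
Qed.

Lemma two_layer_ZE : two_layer_Z N q a b c d = Z%:E.
Proof. by rewrite -esum_word_weight -[in RHS](preimage_setT (@height N)) -two_layer_esum. Qed.

(** Both the stationary law and the matrix product are balanced; uniqueness holds up
to a factor, which the total masses determine. *)
Lemma stationary_measureE alpha beta gamma delta (mu : probability (config N) R) :
  asep_parameters q a b c d alpha beta gamma delta ->
  asep_stationary alpha beta gamma delta q mu ->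
  forall s, fine (mu [set s]) = F s / Z.
Proof.
move=> hpar /stationary_balanced mub s.
have [[al0 be0 ga0 de0] _ _ _ _] := hpar.
have q0 : 0 <= q by case/andP: hq.
have Z0 := normalization_gt0.
have F0 u : 0 < F u by exact: word_weight_gt0.
have muT : \sum_u fine (mu [set u]) = 1.
  apply: EFin_inj; rewrite -(@probability_setT _ _ _ mu) [RHS]probability_config.
  rewrite esum_finType; last by move=> u; exact: fine_ge0.
  by congr EFin; apply: eq_bigl => u; rewrite in_setT.
apply: (mulIf (lt0r_neq0 Z0)); rewrite divfK ?gt_eqF//.
apply: (@balanced_unique R (config N) (@asep_rate R N alpha beta gamma delta q) _
  F F0 (word_weight_balanced hpar) [ffun=> false] _ (fun u => fine (mu [set u]) * Z)).
- by move=> u t; apply: asep_rate_ge0 => //; exact: ltW.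
- by apply: asep_reach_empty => //; exact: ltW.
- by move=> t; under eq_bigr => u _ do rewrite mulrAC; rewrite -big_distrl mub mulrAC.
- by rewrite -big_distrl /= muT mul1r.
Qed.

End StationaryMeasure.

Theorem theorem2p5 (R : realType) (N : nat) (q a b c d : R)
    (hq : 0 <= q < 1) (ha : 0 <= a) (hb : 0 <= b)
    (hc : -1 < c <= 0) (hd : -1 < d <= 0) (hab : a * b < 1) :
  (two_layer_Z N q a b c d < +oo)%E /\
  exists P : probability (two_layer N) R,
    [/\ forall l, P [set l] = (two_layer_prob q a b c d l)%:E,
        exists mu : probability (config N) R,
          asep_stationary_measure q a b c d mu &
        forall mu : probability (config N) R,
          asep_stationary_measure q a b c d mu ->
          pushforward P (@layer1 N) = pushforward mu (@height N)].
Proof.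
pose F (s : config N) := word_weight q a b c d (word s).
pose Z := normalization N q a b c d.
have Z0 : 0 < Z by exact: normalization_gt0.
have F0 s : 0 < F s by exact: word_weight_gt0.
have wt0 := @two_layer_wt_ge0 R q a b c d N hq ha hb hc hd.
have ZE : two_layer_Z N q a b c d = Z%:E by exact: two_layer_ZE.
split; first by rewrite ZE ltry.
have [P PE] := weighted_probability wt0 ZE Z0.
have FZ : \esum_(s in [set: config N]) (F s)%:E = Z%:E by exact: esum_word_weight.
have [nu nuE] := weighted_probability (fun s => ltW (F0 s)) FZ Z0.
have nu1 s : fine (nu [set s]) = F s / Z.
  by rewrite nuE esum_set1 ?lee_fin ?ltW.
exists P; split.
- move=> l; rewrite PE esum_set1 ?lee_fin// -EFinM.
  by rewrite /two_layer_prob ZE.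
- have [alpha [beta [gamma [delta hpar]]]] := asep_parameters_exist hq ha hb hc hd.
  exists nu, alpha, beta, gamma, delta; split=> //.
  apply/stationary_balanced => t; rewrite nu1.
  under eq_bigr => s _ do rewrite nu1 mulrAC.
  have Fb : balanced (asep_rate alpha beta gamma delta q) F.
    exact: (word_weight_balanced (N := N) hq ha hb hc hd hab hpar).
  by rewrite -big_distrl /= Fb mulrAC.
- move=> mu [alpha [beta [gamma [delta [hpar hmu]]]]].
  apply/funext => B; rewrite /pushforward PE two_layer_esum//.
  rewrite -nuE !probability_config; apply: eq_esum => s _.
  by rewrite nu1 (stationary_measureE hq ha hb hc hd hab hpar hmu).
Qed.
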